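(* Let $N\ge1$, $\delta>0$, $\alpha>0$. Suppose each $c_n:\mathbb{R}\to\mathbb{R}$ ($n=1,\dots,N$) is continuous, satisfies $c_n(s)=0$ for $s\le 0$, and is convex and strictly increasing on $[0,\infty)$. Suppose the social cost minimization problem has an optimal solution $(\mathbf{s}^*,y^* )$ with $y^*>0$. Let $(\mathbf{s}^t,y^t)$ be the allocation at the price-taking market equilibrium $(\mathbf{b}^t,p^t,y^t)$, where $s^t_n=S(b^t_n,p^t)$. Then $$\sum_n c_n(s_n^t)+\alpha y^t\ \le\ \sum_n c_n(s_n^* )+\alpha y^*+\frac{\alpha\delta}{2N}.$$
   Context: There are $N$ tenants; $\delta$ is the total energy reduction target; $y$ is the amount of on-site generation, with unit cost $\alpha$. The social cost minimization problem is $$\min\ \alpha y+\sum_{i=1}^N c_i(s_i)\quad\text{s.t.}\quad y+\sum_{i=1}^N s_i=\delta,\ s_i\ge0,\ y\ge0.$$ Supply function: $S(b_n,p)=\delta-\frac{b_n}{p}$ for bid $b_n\ge0$ and price $p>0$. Clearing price: $p(\mathbf{b},y)=\frac{\sum_n b_n}{(N-1)\delta+y}$ (conventions $0/0=0$, $x/0=+\infty$ for $x>0$). Payoff of a price-taking tenant: $P_n(b_n;p)=p\delta-b_n-c_n\!\left(\delta-\frac{b_n}{p}\right)$. A price-taking market equilibrium is a triple $(\mathbf{b},p,y)$ with $\mathbf b\ge 0$, $p>0$ such that $P_n(b_n;p)\ge P_n(\bar b_n;p)$ for all $\bar b_n\ge0$ and all $n$; $p=p(\mathbf{b},y)$; and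 $y\in\arg\min_{0\le y'\le\delta}(\delta-y')p(\mathbf{b},y')+\alpha y'$. *)

(* Defs.v *)
From mathcomp Require Import all_boot all_order all_algebra.
From mathcomp Require Import all_classical all_reals all_analysis.

Set Implicit Arguments.
Unset Strict Implicit.
Unset Printing Implicit Defensive.

Import Order.TTheory GRing.Theory Num.Theory.
Import numFieldNormedType.Exports.

Local Open Scope classical_set_scope.
Local Open Scope ring_scope.

Definition admissible_cost (R : realType) (f : R -> R) : Prop :=
  [/\ continuous f,
      (forall s, s <= 0 -> f s = 0),
      convex_function (E := R^o) (`[0, +oo[%classic : set R^o) f
    & {in `[0, +oo[ &, {homo f : x y / x < y}}].

Definition social_cost (R : realType) (N : nat) (alpha : R)
    (c : 'I_N -> R -> R) (s : 'I_N -> R) (y : R) : R :=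
  alpha * y + \sum_(i < N) c i (s i).

Definition feasible (R : realType) (N : nat) (delta : R)
    (s : 'I_N -> R) (y : R) : Prop :=
  [/\ y + \sum_(i < N) s i = delta, (forall i, 0 <= s i) & 0 <= y].

Definition social_optimum (R : realType) (N : nat) (delta alpha : R)
    (c : 'I_N -> R -> R) (s : 'I_N -> R) (y : R) : Prop :=
  feasible delta s y /\
  forall (s' : 'I_N -> R) (y' : R), feasible delta s' y' ->
    social_cost alpha c s y <= social_cost alpha c s' y'.

Definition supply (R : realType) (delta b p : R) : R := delta - b / p.

(* Extended-real division: 0^-1 = +oo and 0 * +oo = 0 in \bar R, so that
   0 / 0 = 0 and x / 0 = +oo for x > 0.  The denominator vanishes (for N >= 1,
   delta > 0 and y >= 0) exactly when N = 1 and y = 0. *)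
Definition clearing_price (R : realType) (N : nat) (delta : R)
    (b : 'I_N -> R) (y : R) : \bar R :=
  ((\sum_(i < N) b i)%:E / ((N%:R - 1) * delta + y)%:E)%E.

Definition payoff (R : realType) (delta : R) (f : R -> R) (p b : R) : R :=
  p * delta - b - f (supply delta b p).

Definition operator_cost (R : realType) (N : nat) (delta alpha : R)
    (b : 'I_N -> R) (y : R) : \bar R :=
  ((delta - y)%:E * clearing_price delta b y + (alpha * y)%:E)%E.

Record price_taking_equilibrium (R : realType) (N : nat) (delta alpha : R)
    (c : 'I_N -> R -> R) (b : 'I_N -> R) (p y : R) : Prop := {
  bids_ge0 : forall n, 0 <= b n;
  price_gt0 : 0 < p;
  bids_optimal : forall n (b' : R), 0 <= b' ->
    payoff delta (c n) p b' <= payoff delta (c n) p (b n);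
  price_clears : p%:E = clearing_price delta b y;
  generation_range : 0 <= y <= delta;
  generation_optimal : forall y' : R, 0 <= y' <= delta ->
    (operator_cost delta alpha b y <= operator_cost delta alpha b y')%E }.

(* Main.v *)
(* The argument only needs the first-order information carried by three
   comparisons.  Writing s = S(b, p), a tenant's payoff is p s - c_n(s) with
   s <= delta, so comparing s^t with s* and summing bounds the excess cost by
   (alpha - p)(y^t - y* ).  With D' = (N - 1) delta + y', moving the operator from
   y to y' changes its cost by (y' - y)(alpha - p N delta / D').  If y^t < y*, the
   choice y' = delta gives p <= alpha and the excess is nonpositive.  If
   y^t >= y* > 0, the choice y' = y / 2 gives
   alpha - p <= alpha (delta - y / 2) / (N delta), and (delta - y / 2) y is at most
   delta^2 / 2 on [0, delta]. *)
Require Import Defs.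
From mathcomp Require Import all_boot all_order all_algebra.
From mathcomp Require Import all_classical all_reals all_analysis.
From mathcomp Require Import ring lra.

Set Implicit Arguments.
Unset Strict Implicit.
Unset Printing Implicit Defensive.

Import Order.TTheory GRing.Theory Num.Theory.
Import numFieldNormedType.Exports.

Local Open Scope ring_scope.

Lemma clearing_price_fin (R : realType) (N : nat) (delta y : R)
    (b : 'I_N -> R) : (N%:R - 1) * delta + y != 0 ->
  clearing_price delta b y =
    ((\sum_(i < N) b i) / ((N%:R - 1) * delta + y))%:E.
Proof. by move=> D0; rewrite /clearing_price inver (negbTE D0) -EFinM. Qed.

Lemma payoff_supply (R : realType) (delta p b : R) (f : R -> R) : p != 0 ->
  payoff delta f p b = p * supply delta b p - f (supply delta b p).
Proof. by move=> p0; rewrite /payoff /supply mulrBr mulrC [p * (_ / _)]mulrC divfK. Qed.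

Lemma feasible_le (R : realType) (N : nat) (delta : R) (s : 'I_N -> R) (y : R) :
  feasible delta s y -> y <= delta /\ forall i, s i <= delta.
Proof.
case=> sumE s0 y0; split=> [|i].
  by rewrite -sumE lerDl sumr_ge0.
rewrite -sumE (bigD1 i) //= addrCA lerDl addr_ge0 //.
exact: sumr_ge0.
Qed.

Section Equilibrium.

Variables (R : realType) (N : nat) (delta alpha : R) (c : 'I_N -> R -> R).
Variables (b : 'I_N -> R) (p y : R).
Hypotheses (N_gt0 : (0 < N)%N) (delta_gt0 : 0 < delta).
Hypothesis eqm : price_taking_equilibrium delta alpha c b p y.

Local Notation D z := ((N%:R - 1) * delta + z).

Let N1delta_ge0 : 0 <= (N%:R - 1) * delta.
Proof. by rewrite mulr_ge0 ?subr_ge0 ?ler1n // ltW. Qed.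

(** If [D y] vanished, the conventions for division by zero would make the clearing price 0 or
    [+oo], and neither is a positive real [p]. *)
Lemma equilibrium_denom_gt0 : 0 < D y.
Proof.
have /andP[y0 _] := generation_range eqm.
rewrite lt_neqAle addr_ge0 // andbT eq_sym; apply/eqP => D0.
have := price_clears eqm; rewrite /clearing_price D0 inver eqxx.
have: 0 <= \sum_(i < N) b i by apply: sumr_ge0 => i _; exact: bids_ge0 eqm i.
rewrite le_eqVlt => /orP[/eqP<-|B0]; last by rewrite mulry gtr0_sg // mul1e.
by rewrite mul0e => -[p0]; have := price_gt0 eqm; rewrite p0 ltxx.
Qed.

Lemma equilibrium_bid_sum : \sum_(i < N) b i = p * D y.
Proof.
have D0 := lt0r_neq0 equilibrium_denom_gt0.
have := price_clears eqm; rewrite clearing_price_fin // => -[->].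
by rewrite divfK.
Qed.

Lemma equilibrium_supply_sum :
  \sum_(i < N) supply delta (b i) p = delta - y.
Proof.
have p0 := lt0r_neq0 (price_gt0 eqm).
rewrite /supply sumrB -mulr_suml equilibrium_bid_sum sumr_const card_ord.
by rewrite -mulr_natl; field.
Qed.

(** The bid [p * (delta - s)] yields supply [s] and is nonnegative exactly when [s <= delta], so
    supplies can be compared in place of bids. *)
Lemma equilibrium_supply_optimal n s : s <= delta ->
  p * s - c n s <= p * supply delta (b n) p - c n (supply delta (b n) p).
Proof.
move=> sd; have p0 := price_gt0 eqm; have pN0 := lt0r_neq0 p0.
have b'0 : 0 <= p * (delta - s) by rewrite mulr_ge0 ?subr_ge0 // ltW.
have := bids_optimal eqm n b'0; rewrite !payoff_supply //.
have -> // : supply delta (p * (delta - s)) p = s by rewrite /supply; field.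
Qed.

Lemma equilibrium_generation_optimal z : 0 < z <= delta ->
  0 <= (z - y) * (alpha * D z - p * (N%:R * delta)).
Proof.
move=> /andP[z0 zd]; have Dy0 := equilibrium_denom_gt0.
(* Strict positivity of [z] keeps the deviation cost finite even when [N = 1]. *)
have Dz0 : 0 < D z by rewrite ltr_wpDl.
have zr : 0 <= z <= delta by rewrite (ltW z0).
have := generation_optimal eqm zr.
rewrite /operator_cost !clearing_price_fin ?lt0r_neq0 // -!EFinM -!EFinD lee_fin.
rewrite equilibrium_bid_sum mulfK ?lt0r_neq0 // -subr_ge0.
(* The factor [z - y] comes from [(delta - z) * D y - (delta - y) * D z = (y - z) * (N%:R *
   delta)]. *)
have -> : (delta - z) * (p * D y / D z) + alpha * z
    - ((delta - y) * p + alpha * y)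
    = (z - y) * (alpha * D z - p * (N%:R * delta)) / D z.
  by field; rewrite lt0r_neq0.
by rewrite pmulr_lge0 // invr_gt0.
Qed.

Lemma equilibrium_excess_cost (s : 'I_N -> R) (z : R) : feasible delta s z ->
  \sum_(n < N) c n (supply delta (b n) p) + alpha * y
    - (\sum_(n < N) c n (s n) + alpha * z) <= (alpha - p) * (y - z).
Proof.
move=> fs; have [_ sd] := feasible_le fs; case: fs => sumE _ _.
have : \sum_(n < N) (p * s n - c n (s n)) <=
    \sum_(n < N) (p * supply delta (b n) p - c n (supply delta (b n) p)).
  by apply: ler_sum => n _; exact: equilibrium_supply_optimal.
rewrite !sumrB -!mulr_sumr equilibrium_supply_sum.
have -> : \sum_(n < N) s n = delta - z by rewrite -sumE addrAC subrr add0r.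
lra.
Qed.

Lemma equilibrium_price_le : 0 < alpha -> y < delta -> p <= alpha.
Proof.
move=> alpha0 yd.
have dd : 0 < delta <= delta by rewrite delta_gt0 lexx.
have := equilibrium_generation_optimal dd.
have -> : alpha * D delta - p * (N%:R * delta)
    = (alpha - p) * (N%:R * delta) by ring.
rewrite pmulr_rge0 ?subr_gt0 // pmulr_lge0 ?subr_ge0 //.
by rewrite mulr_gt0 // ltr0n.
Qed.

(** Any [z] in [(0, y)] gives the bound with [delta - z]. Letting [z] tend to [y] would sharpen it,
    but [z = y / 2] suffices and avoids a limit. *)
Lemma equilibrium_price_ge : 0 < y ->
  alpha - p <= alpha * (delta - y / 2) / (N%:R * delta).
Proof.
move=> y0; have /andP[_ yd] := generation_range eqm.
have y2 : 0 < y / 2 <= delta by lra.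
have := equilibrium_generation_optimal y2.
have -> : y / 2 - y = - (y / 2) by lra.
rewrite mulNr oppr_ge0 pmulr_rle0; last lra.
rewrite ler_pdivlMr; last by rewrite mulr_gt0 // ltr0n.
lra.
Qed.

End Equilibrium.

Theorem theorem5 (R : realType) (N : nat) (delta alpha : R)
    (c : 'I_N -> R -> R)
    (hN : (1 <= N)%N) (hdelta : 0 < delta) (halpha : 0 < alpha)
    (hc : forall n, admissible_cost (c n))
    (sstar : 'I_N -> R) (ystar : R)
    (hstar : social_optimum delta alpha c sstar ystar)
    (hystar : 0 < ystar)
    (bt : 'I_N -> R) (pt yt : R)
    (heq : price_taking_equilibrium delta alpha c bt pt yt)
    (st : 'I_N -> R) (hst : forall n, st n = supply delta (bt n) pt) :
  \sum_(n < N) c n (st n) + alpha * yt <=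
    \sum_(n < N) c n (sstar n) + alpha * ystar + alpha * delta / (2 * N%:R).
Proof.
have [fs _] := hstar; have [ysd _] := feasible_le fs.
have /andP[_ yd] := generation_range heq.
have Nd0 : 0 < N%:R * delta by rewrite mulr_gt0 // ltr0n.
have NN0 : N%:R != 0 :> R by rewrite pnatr_eq0 -lt0n.
under eq_bigr do rewrite hst.
rewrite -lerBlDl; apply: le_trans (equilibrium_excess_cost hN hdelta heq fs) _.
have [yy|yy] := ltP yt ystar.
  (* Here [yt < ystar <= delta], so raising generation to [delta] is a genuine deviation. *)
  have pa := equilibrium_price_le hN hdelta heq halpha (lt_le_trans yy ysd).
  apply: (@le_trans _ _ 0); first by rewrite mulr_ge0_le0 // ?subr_ge0 // subr_le0 ltW.
  by rewrite divr_ge0 ?mulr_ge0 ?ler0n // ltW.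
have y0 := lt_le_trans hystar yy.
have pa := equilibrium_price_ge hN hdelta heq y0.
apply: le_trans (ler_wpM2r _ pa) _; first by rewrite subr_ge0.
have -> : alpha * delta / (2 * N%:R) = alpha * (delta ^+ 2 / 2) / (N%:R * delta).
  by field; rewrite NN0 lt0r_neq0.
rewrite mulrAC ler_pM2r ?invr_gt0 // -mulrA ler_pM2l //.
(* Drop [ystar] from [yt - ystar]; what remains is equivalent to [0 <= (delta - yt) ^+ 2]. *)
apply: (@le_trans _ _ ((delta - yt / 2) * yt)).
  by rewrite ler_wpM2l; lra.
have := sqr_ge0 (delta - yt); lra.
Qed.
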